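(* Let $\mathbb{T}\mathbb{C}$ be the tropical complex hyperfield and $\mathbb{T}$ the tropical hyperfield. The hyperfield homomorphism $\eta:\mathbb{T}\mathbb{C}\to\mathbb{T}$, $\eta(z)=\log(|z|)$ (with $\eta(0)=-\infty$), is relatively algebraically closed (RAC).
   Context: A hyperoperation on a set $\mathbb{H}$ is a map $\boxplus:\mathbb{H}\times\mathbb{H}\to\{\text{nonempty subsets of }\mathbb{H}\}$; for subsets, $A\boxplus B=\bigcup_{a\in A,b\in B}(a\boxplus b)$, and finite hypersums are defined by iteration. A hyperfield is a tuple $(\mathbb{H},\odot,\boxplus,1,0)$ with $0\ne 1$ such that: $(\mathbb{H},\odot,1)$ is a commutative monoid in which every nonzero element is invertible; $\boxplus$ is a commutative and associative hyperoperation; $0\boxplus x=\{x\}$; for each $x$ there is a unique $-x$ with $0\in x\boxplus(-x)$; $x\in y\boxplus z$ iff $z\in x\boxplus(-y)$; $0\odot x=0$; and $a\odot(x\boxplus y)=(a\odot x)\boxplus(a\odot y)$. The tropical complex hyperfield $\mathbb{T}\mathbb{C}$ has underlying set $\mathbb{C}$, the usual complex multiplication, and hyperaddition: $z\boxplus w=\{c\in\mathbb{C}:|c|\le|z|\}$ if $w=-z$; $z\boxplus w=\{z\}$ if $|z|>|w|$; $z\boxplus w=\{w\}$ if $|w|>|z|$; $z\boxplus z=\{z\}$ for $z\ne0$; and if $|z|=|w|$, $z\ne\pm w$, then $z\boxplus w$ is the shortest closed arc connecting $z$ and $w$ on the circle of radius $|z|$ centred at $0$. Neutral elements are $0$ and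 $1$. The tropical hyperfield $\mathbb{T}$ has underlying set $\mathbb{R}\cup\{-\infty\}$, multiplication $x\odot y=x+y$ (with $x\odot(-\infty)=-\infty$), and hyperaddition $x\boxplus y=\{\max(x,y)\}$ if $x\neq y$, $x\boxplus x=\{z: z\le x\}$ (including $-\infty$). Its additive neutral element is $-\infty$ and its multiplicative neutral element is the real number $0$. A hyperfield homomorphism $f:\mathbb{H}_1\to\mathbb{H}_2$ is a map with $f(x\boxplus_1 y)\subseteq f(x)\boxplus_2 f(y)$, $f(x\odot_1 y)=f(x)\odot_2 f(y)$, preserving both neutral elements. $\mathbb{H}[X]$ is the set of formal expressions $p=\boxplus_{i=0}^n c_i\odot X^i$ with $c_i\in\mathbb{H}$; $p(a)=\boxplus_i c_i\odot a^i\subseteq\mathbb{H}$; $V(p)=\{a\in\mathbb{H}:0\in p(a)\}$ is the set of roots of $p$ ($0$ the additive neutral element). The push-forward of $p\in\mathbb{H}_1[X]$ is $f_*(p)=\boxplus_i f(c_i)\odot X^i\in\mathbb{H}_2[X]$. A hyperfield homomorphism $f:\mathbb{H}_1\to\mathbb{H}_2$ is relatively algebraically closed (RAC) if for all univariate $p\in\mathbb{H}_1[X]$ and every root $b\in V(f_*(p))$ there exists $a\in f^{-1}(b)$ with $a\in V(p)$. *)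

(* Defs.v *)
From mathcomp Require Import all_boot all_order all_algebra.
From mathcomp Require Import boolp classical_sets reals exp trigo.
From mathcomp Require Import complex.
From mathcomp Require Import ring lra.

Set Implicit Arguments.
Unset Strict Implicit.
Unset Printing Implicit Defensive.
Import Order.TTheory GRing.Theory Num.Theory.
Import ComplexField.Normc.
Local Open Scope classical_set_scope.
Local Open Scope ring_scope.

Definition hset_add (T : Type) (add : T -> T -> set T) (A B : set T) : set T :=
  [set c | exists a b, [/\ A a, B b & add a b c]].

Record hyperfield := Hyperfield {
  hcarrier :> Type;
  hmul : hcarrier -> hcarrier -> hcarrier;
  hadd : hcarrier -> hcarrier -> set hcarrier;
  hone : hcarrier;
  hzero : hcarrier;
  hopp : hcarrier -> hcarrier;
  hzero_neq_one : hzero <> hone;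
  hmulA : forall x y z, hmul x (hmul y z) = hmul (hmul x y) z;
  hmulC : forall x y, hmul x y = hmul y x;
  hmul1 : forall x, hmul hone x = x;
  hmulV : forall x, x <> hzero -> exists y, hmul x y = hone;
  hmul0 : forall x, hmul hzero x = hzero;
  hadd_nonempty : forall x y, hadd x y !=set0;
  haddC : forall x y, hadd x y = hadd y x;
  haddA : forall x y z,
    hset_add hadd [set x] (hadd y z) = hset_add hadd (hadd x y) [set z];
  hadd0 : forall x, hadd hzero x = [set x];
  (* existence and uniqueness of the additive inverse *)
  hadd_opp : forall x y, hadd x y hzero <-> y = hopp x;
  hadd_rev : forall x y z, hadd y z x <-> hadd x (hopp y) z;
  hmulDr : forall a x y,
    [set hmul a c | c in hadd x y] = hadd (hmul a x) (hmul a y) }.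

Arguments hmul {_}. Arguments hadd {_}. Arguments hone {_}.
Arguments hzero {_}. Arguments hopp {_}.

Record hmorphism (H1 H2 : hyperfield) := HMorphism {
  hfun :> H1 -> H2;
  hfun_add : forall x y, [set hfun c | c in hadd x y] `<=` hadd (hfun x) (hfun y);
  hfun_mul : forall x y, hfun (hmul x y) = hmul (hfun x) (hfun y);
  hfun_zero : hfun hzero = hzero;
  hfun_one : hfun hone = hone }.

Definition hexp (H : hyperfield) (a : H) (n : nat) : H := iter n (hmul a) hone.

(* The expression c_0 + c_1 X + ... + c_n X^n is encoded by [:: c_0; ...; c_n];
   leading coefficients may vanish. *)
Definition hpoly (H : hyperfield) := seq H.

(* The unit [set hzero] of the iterated set addition accounts for the empty
   sequence, whose value is {0}. *)
Definition heval (H : hyperfield) (p : hpoly H) (a : H) : set H :=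
  \big[hset_add hadd / [set hzero]]_(i < size p)
    [set hmul (nth hzero p i) (hexp a i)].

Definition hroots (H : hyperfield) (p : hpoly H) : set H :=
  [set a | heval p a hzero].

Definition hpush (H1 H2 : hyperfield) (f : hmorphism H1 H2) (p : hpoly H1) :
  hpoly H2 := map f p.

Definition RAC (H1 H2 : hyperfield) (f : hmorphism H1 H2) : Prop :=
  forall (p : hpoly H1) (b : H2), hroots (hpush f p) b ->
    exists a : H1, f a = b /\ hroots p a.

Section TropicalComplex.
Variable R : realType.
Implicit Types (z w c d u v : R[i]) (s t : R).

Definition rot t : R[i] := (cos t +i* sin t)%C.

(* The shortest closed arc from z to w when |w| = |z| and w <> - z: the angle
   phi from z to w is taken in ]-pi, pi[, and c turns from z towards w. *)
Definition tc_arc z w : set R[i] :=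
  [set c | exists phi t, [/\ - pi < phi < pi, 0 <= t <= 1,
     w = z * rot phi & c = z * rot (t * phi)]].

Definition tc_add z w : set R[i] :=
  if w == - z then [set c | normc c <= normc z]
  else if normc w < normc z then [set z]
  else if normc z < normc w then [set w]
  else if w == z then [set z]
  else tc_arc z w.

Definition cone z w : set R[i] :=
  [set c | exists s t, [/\ 0 <= s, 0 <= t & c = s%:C%C * z + t%:C%C * w]].

Lemma normc_ge0 z : 0 <= normc z.
Proof. by case: z => a b; rewrite /normc sqrtr_ge0. Qed.

Lemma normc_eq0 z : (normc z == 0) = (z == 0).
Proof.
by apply/eqP/eqP => [/eq0_normc//|->]; rewrite normc0.
Qed.

Lemma normcNE z : normc (- z) = normc z.
Proof. by case: z => a b; rewrite /normc /= !sqrrN. Qed.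

Lemma normc_real s : 0 <= s -> normc s%:C%C = s.
Proof. by move=> s0; rewrite /normc /= expr0n addr0 sqrtr_sqr ger0_norm. Qed.

Lemma normc_rot t : normc (rot t) = 1.
Proof. by rewrite /normc /= cos2Dsin2 sqrtr1. Qed.

Lemma normc_eq1 (a b : R) : normc (a +i* b)%C = 1 -> a ^+ 2 + b ^+ 2 = 1.
Proof.
rewrite /normc /= => h; rewrite -[LHS]sqr_sqrtr ?h ?expr1n //.
by rewrite addr_ge0 ?sqr_ge0.
Qed.

Lemma rot_cone phi t : - pi < phi < pi -> 0 <= t <= 1 ->
  cone 1 (rot phi) (rot (t * phi)).
Proof.
move=> phiP /andP[t0 t1]; have [->|phi0] := eqVneq phi 0.
  exists 1, 0; rewrite mulr0 mul0r addr0 mulr1 /rot cos0 sin0.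
  by split=> //; rewrite ler01.
have main (f : R) : 0 < f < pi ->
    cone 1 (rot f) (rot (t * f)) /\ cone 1 (rot (- f)) (rot (t * - f)).
  move=> /andP[f0 fpi].
  have sf : 0 < sin f by rewrite sin_gt0_pi // f0.
  have h1 : 0 <= sin ((1 - t) * f).
    apply: sin_ge0_pi; apply/andP; split; first by apply: mulr_ge0; lra.
    by apply: (le_trans (y := f)); [rewrite ler_piMl; lra|lra].
  have h2 : 0 <= sin (t * f).
    apply: sin_ge0_pi; apply/andP; split; first by apply: mulr_ge0; lra.
    by apply: (le_trans (y := f)); [rewrite ler_piMl; lra|lra].
  have e : sin ((1 - t) * f) = sin f * cos (t * f) - cos f * sin (t * f).
    by rewrite mulrBl mul1r sinB.
  have q1 : cos (t * f) = sin ((1 - t) * f) / sin f + sin (t * f) / sin f * cos f.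
    by rewrite e; field; lra.
  have q2 : sin (t * f) = sin (t * f) / sin f * sin f by field; lra.
  split; exists (sin ((1 - t) * f) / sin f), (sin (t * f) / sin f);
    rewrite !divr_ge0 ?(ltW sf) //; split => //;
    rewrite /rot ?mulrN ?cosN ?sinN; apply/eqP; rewrite eq_complex /=;
    rewrite !(mul0r, mulr0, mulr1, addr0, subr0, add0r, sub0r, mulrN, oppr0).
    by rewrite -q1 -q2 !eqxx.
  by rewrite -q1 -q2 !eqxx.
have [p|n] := ltP 0 phi.
  by apply: (main phi _).1; lra.
have -> : phi = - - phi by rewrite opprK.
by apply: (main (- phi) _).2; move/eqP: phi0; lra.
Qed.

Lemma cone_ge_re (a b s t : R) : a ^+ 2 + b ^+ 2 = 1 -> 0 <= s -> 0 <= t ->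
  (s + t * a) ^+ 2 + (t * b) ^+ 2 = 1 -> a <= s + t * a.
Proof.
move=> ab s0 t0 e; rewrite leNgt; apply/negP => h.
have e' : s ^+ 2 + 2 * s * t * a + t ^+ 2 = 1 by nra.
have a1 : 0 <= 1 - a ^+ 2 by nra.
have [t1|t1] := leP t 1; have [a0|a0] := leP 0 a.
- have : 0 <= (1 - t) * (1 + t) * (1 - a ^+ 2).
    by apply: mulr_ge0 => //; apply: mulr_ge0; lra.
  have : 0 < ((1 - t) * a - s) * ((1 - t) * a + s + 2 * t * a).
    apply: mulr_gt0; first by lra.
    have h1 : 0 <= t * a by exact: mulr_ge0.
    by nra.
  by nra.
- by nra.
- by nra.
- have : 0 <= (t - 1) * (1 + t) * (1 - a ^+ 2).
    by apply: mulr_ge0 => //; apply: mulr_ge0; lra.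
  have : 0 < ((1 - t) * a - s) * (- 2 * t * a - s - (1 - t) * a).
    by apply: mulr_gt0; nra.
  by nra.
Qed.

Lemma cone_rot u v : normc u = 1 -> u != - 1 -> normc v = 1 -> cone 1 u v ->
  exists phi t, [/\ - pi < phi < pi, 0 <= t <= 1, u = rot phi &
     v = rot (t * phi)].
Proof.
case: u v => [a b] [x y] u1 uN v1 [s [t [s0 t0]]].
rewrite mulr1 => /eqP; rewrite eq_complex /= !mul0r subr0 add0r addr0.
move=> /andP[/eqP xE /eqP yE].
have {u1}ab := normc_eq1 u1; have {v1}xy := normc_eq1 v1.
have ax : a <= x by rewrite xE; apply: (cone_ge_re ab) => //; rewrite -xE -yE.
have aN1 : -1 < a.
  rewrite lt_neqAle; apply/andP; split; last by nra.
  apply: contra uN => /eqP aE; rewrite eq_complex /= -aE eqxx /= oppr0.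
  by rewrite -sqrf_eq0; apply/eqP; move: ab; rewrite -aE; lra.
have a1 : a <= 1 by nra.
have x1 : x <= 1 by nra.
have aI : -1 < a <= 1 by rewrite aN1.
have aI' : -1 <= a <= 1 by rewrite ltW.
have xI : -1 <= x <= 1 by rewrite x1 andbT; lra.
pose g := if 0 <= b then 1 else -1 : R.
have g2 : g * g = 1 by rewrite /g; case: ifP => _; lra.
have gb : g * `|b| = b.
  rewrite /g; case: (lerP 0 b) => b0; first by rewrite ger0_norm ?mul1r.
  by rewrite ltr0_norm ?mulN1r ?opprK.
have rotg (q r : R) : -1 <= q <= 1 -> q ^+ 2 + r ^+ 2 = 1 -> g * `|r| = r ->
    rot (g * acos q) = (q +i* r)%C.
  move=> qI qr gr.
  have c1 : cos (acos q) = q by rewrite acosK.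
  have s1 : sin (acos q) = `|r|.
    by rewrite sin_acos // -sqrtr_sqr; congr (Num.sqrt _); lra.
  rewrite -[in RHS]gr -[in RHS]c1 -s1 /rot /g; case: ifP => _.
    by rewrite !mul1r.
  by rewrite !mulN1r cosN sinN.
have uE := rotg a b aI' ab gb.
have vE : rot (g * acos x) = (x +i* y)%C.
  apply: rotg => //; rewrite yE normrM (ger0_norm t0).
  by rewrite mulrCA gb.
have ltpi := acos_ltpi aI.
have ge0a := acos_ge0 aI'.
have ge0x := acos_ge0 xI.
have le_ax : acos x <= acos a.
  rewrite leNgt; apply/negP => lt_ax.
  have : cos (acos x) < cos (acos a).
    rewrite ltr_cos // in_itv /= ?ge0a ?ge0x ?(ltW ltpi) //.
    by rewrite acos_lepi.
  by rewrite !acosK ?in_itv //=; lra.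
exists (g * acos a), (acos x / acos a); split.
- by rewrite /g; case: ifP => _; lra.
- have [e|n] := eqVneq (acos a) 0; first by rewrite e invr0 mulr0 lexx ler01.
  have p : 0 < acos a by rewrite lt_neqAle eq_sym n.
  by rewrite divr_ge0 //= ler_pdivrMr // mul1r.
- by rewrite uE.
- rewrite -vE mulrCA; congr (rot (_ * _)).
  have [e|n] := eqVneq (acos a) 0; last by rewrite divfK.
  by move: le_ax; rewrite e mulr0; lra.
Qed.

Lemma tc_arcE z w : z != 0 -> normc z = normc w -> w != - z ->
  tc_arc z w = [set c | normc c = normc z /\ cone z w c].
Proof.
move=> z0 zw wN; apply/seteqP; split=> c /=.
  move=> [phi [t [phiP tP -> ->]]]; rewrite normcM normc_rot mulr1; split=> //.
  have [s [r [s0 r0 ->]]] := rot_cone phiP tP.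
  by exists s, r; split => //; ring.
move=> [cz [s [t [s0 t0 cE]]]].
have nz0 : normc z != 0 by rewrite normc_eq0.
have [||||phi [r [h1 h2 h3 h4]]] := @cone_rot (w / z) (c / z).
- by rewrite normcM normcV -zw divff.
- by apply: contra wN => /eqP e; rewrite -[w](divfK z0) e mulN1r.
- by rewrite normcM normcV cz divff.
- by exists s, t; split => //; rewrite cE mulr1; field.
exists phi, r; split=> //.
- by rewrite -h3 mulrC divfK.
- by rewrite -h4 mulrC divfK.
Qed.

Lemma tc_addN z : tc_add z (- z) = [set c | normc c <= normc z].
Proof. by rewrite /tc_add eqxx. Qed.

Lemma tc_add_gt z w : normc w < normc z -> tc_add z w = [set z].
Proof.
rewrite /tc_add; case: eqP => [->|_ ->//].
by rewrite normcNE ltxx.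
Qed.

Lemma tc_add_lt z w : normc z < normc w -> tc_add z w = [set w].
Proof.
rewrite /tc_add; case: eqP => [->|_ h]; first by rewrite normcNE ltxx.
by rewrite h ltNge (ltW h).
Qed.

Lemma cone_id z c : normc c = normc z -> cone z z c -> c = z.
Proof.
move=> cz [s [t [s0 t0]]]; rewrite -mulrDl -rmorphD => cE.
have [z0|z0] := eqVneq z 0; first by rewrite cE z0 mulr0.
move: cz; rewrite cE normcM normc_real ?addr_ge0 // => /eqP.
rewrite -subr_eq0 -[X in _ - X]mul1r -mulrBl mulf_eq0 normc_eq0 (negPf z0).
by rewrite orbF subr_eq0 => /eqP ->; rewrite mul1r.
Qed.

Lemma tc_add_eq z w : normc z = normc w -> w != - z ->
  tc_add z w = [set c | normc c = normc z /\ cone z w c].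
Proof.
move=> zw wN; rewrite /tc_add (negPf wN) zw ltxx.
case: eqP => [->|wz]; last first.
  rewrite -zw tc_arcE //; apply/eqP => z0; apply: wz.
  by move/eqP: zw; rewrite z0 normc0 eq_sym normc_eq0 => /eqP.
apply/seteqP; split=> c /= => [->|[]]; last exact: cone_id.
split=> //; exists 1, 0; rewrite mul0r mul1r addr0.
by split=> //; rewrite ler01.
Qed.

Lemma tc_add_id z c : normc c <= normc z -> tc_add z (- z) c.
Proof. by rewrite tc_addN. Qed.

Lemma coneC z w : cone z w = cone w z.
Proof.
by apply/seteqP; split=> c [s [t [s0 t0 ->]]]; exists t, s; split=> //; rewrite addrC.
Qed.

Lemma tc_addC z w : tc_add z w = tc_add w z.
Proof.
have [wz|wz] := eqVneq w (- z).
  by have := tc_addN (- z); rewrite opprK normcNE wz tc_addN => ->.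
have zw : z != - w by rewrite -eqr_oppLR eq_sym.
have [h|h|h] := ltgtP (normc z) (normc w).
- by rewrite tc_add_lt // tc_add_gt.
- by rewrite tc_add_gt // tc_add_lt.
- by rewrite !tc_add_eq // coneC h.
Qed.

Lemma tc_addl z w : normc z = normc w -> tc_add z w z.
Proof.
move=> zw; have [->|wz] := eqVneq w (- z); first by rewrite tc_addN /=.
rewrite tc_add_eq //; split=> //; exists 1, 0; rewrite mul1r mul0r addr0.
by split=> //; exact: ler01.
Qed.

Lemma tc_addr z w : normc z = normc w -> tc_add z w w.
Proof. by move=> zw; rewrite tc_addC; apply: tc_addl. Qed.

Lemma tc_add_ne z w : tc_add z w !=set0.
Proof.
have [h|h|h] := ltgtP (normc z) (normc w).
- by exists w; rewrite tc_add_lt.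
- by exists z; rewrite tc_add_gt.
- by exists z; exact: tc_addl.
Qed.

Lemma tc_add_le z w c : tc_add z w c ->
  normc c <= normc z \/ normc c <= normc w.
Proof.
have [->|wz] := eqVneq w (- z); first by rewrite tc_addN; left.
have [h|h|h] := ltgtP (normc z) (normc w).
- by rewrite tc_add_lt // => ->; right.
- by rewrite tc_add_gt // => ->; left.
- by rewrite tc_add_eq // => -[-> _]; left.
Qed.

Lemma tc_add_cone z w c : normc z = normc w -> normc c = normc z ->
  cone z w c -> tc_add z w c.
Proof.
move=> zw cz h; have [->|wz] := eqVneq w (- z).
  by rewrite tc_addN /= cz.
by rewrite tc_add_eq.
Qed.

Lemma tc_addA_eq x y z d c : normc x = normc y -> normc y = normc z ->
  tc_add x y d -> tc_add d z c -> exists2 e, tc_add y z e & tc_add x e c.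
Proof.
move=> xy yz.
have [yx|yx] := eqVneq y (- x).
  rewrite yx tc_addN /= => dx /tc_add_le cd; exists (- x).
    by rewrite -yx; exact: tc_addl.
  by rewrite tc_addN /=; case: cd => h; move: dx h; rewrite xy yz; lra.
rewrite tc_add_eq // => -[dn [s [t [s0 t0 dE]]]].
have [zy|zy] := eqVneq z (- y).
  move=> /tc_add_le cd.
  have {}cd : normc c <= normc x by case: cd; rewrite ?dn ?xy ?yz.
  have [cx|cx] := eqVneq (normc c) (normc x).
    exists c; first by rewrite zy tc_addN /= -xy.
    by apply: tc_addr; rewrite cx.
  exists (- x); first by rewrite zy tc_addN /= normcNE xy.
  by rewrite tc_addN.
have [zd|zd] := eqVneq z (- d).
  rewrite zd tc_addN /= => cd; exists (- x); last by rewrite tc_addN /= -dn.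
  rewrite -zd; apply: tc_add_cone => //; first by rewrite normcNE.
  have [se|s1] := eqVneq s 0.
    move: dE; rewrite se mul0r add0r => dE.
    exfalso; move/eqP: zy; apply; rewrite zd; congr (- _).
    apply: (@cone_id _ _); first by rewrite dn.
    by exists t, 0; rewrite lexx mul0r addr0.
  exists (t / s), s^-1; split; rewrite ?divr_ge0 ?invr_ge0 //.
  rewrite zd dE rmorphM fmorphV /=; field.
  by rewrite eq_complex /= negb_and s1.
rewrite tc_add_eq // ?dn ?xy // => -[cn [s' [t' [s'0 t'0 cE]]]].
pose v := (s' * t)%:C%C * y + t'%:C%C * z.
have {}cE : c = (s' * s)%:C%C * x + v.
  by rewrite cE dE /v !rmorphM /=; ring.
have [v0|v0] := eqVneq v 0.
  exists y; first by exact: tc_addl.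
  suff -> : c = x by apply: tc_addl.
  apply: (@cone_id _ _); first by rewrite cn xy.
  by exists (s' * s), 0; rewrite mulr_ge0 // lexx cE v0 mul0r.
have nv : 0 < normc v by rewrite lt_neqAle eq_sym normc_eq0 v0 normc_ge0.
have [y0|y0] := eqVneq (normc y) 0.
  exfalso; move: v0; rewrite /v; move/eqP: (y0); rewrite normc_eq0 => /eqP ->.
  by move: y0; rewrite yz => /eqP; rewrite normc_eq0 => /eqP ->; rewrite !mulr0 addr0 eqxx.
have ny : 0 < normc y by rewrite lt_neqAle eq_sym y0 normc_ge0.
pose k := normc y / normc v.
have k0 : 0 < k by exact: (divr_gt0 ny nv).
have kC : k%:C%C != 0 :> R[i] by rewrite eq_complex /= negb_and gt_eqF.
have en : normc (k%:C%C * v) = normc y.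
  by rewrite normcM normc_real ?(ltW k0) // divfK // gt_eqF.
exists (k%:C%C * v).
  apply: tc_add_cone => //; exists (k * (s' * t)), (k * t').
  have kge := ltW k0.
  split; [exact: mulr_ge0 kge (mulr_ge0 s'0 t0)|exact: mulr_ge0 kge t'0|].
  by rewrite /v !rmorphM /=; ring.
apply: tc_add_cone; rewrite ?en ?cn //.
exists (s' * s), k^-1.
split; [exact: mulr_ge0|by rewrite invr_ge0 ltW|].
by rewrite cE fmorphV /= mulKf.
Qed.

Lemma tc_addA_sub x y z d c :
  tc_add x y d -> tc_add d z c -> exists2 e, tc_add y z e & tc_add x e c.
Proof.
have [xy|xy|xy] := ltgtP (normc x) (normc y).
- rewrite (tc_add_lt xy) => ->.
  have [yz|yz|yz] := ltgtP (normc y) (normc z).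
  + rewrite tc_add_lt // => ->; exists z => //.
    by rewrite tc_add_lt ?(lt_trans xy).
  + by rewrite tc_add_gt // => ->; exists y => //; rewrite tc_add_lt.
  + move=> h; have [cx|cx] := ltP (normc x) (normc c).
      by exists c => //; rewrite tc_add_lt.
    have [zy|zy] := eqVneq z (- y).
      exists (- x); last by rewrite tc_addN.
      by rewrite zy tc_addN /= normcNE ltW.
    move: h cx; rewrite tc_add_eq // => -[-> _]; lra.
- rewrite (tc_add_gt xy) => ->.
  have [xz|xz|xz] := ltgtP (normc x) (normc z).
  + rewrite tc_add_lt // => ->; exists z; rewrite tc_add_lt //.
    by rewrite (lt_trans xy).
  + rewrite tc_add_gt // => ->; have [e eP] := tc_add_ne y z.
    exists e => //; rewrite tc_add_gt //.
    by case: (tc_add_le eP) => /le_lt_trans; apply.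
  + by move=> h; exists z => //; rewrite tc_add_lt // -xz.
- have [yz|yz|yz] := ltgtP (normc y) (normc z).
  + move=> /tc_add_le dP.
    have dz : normc d < normc z by case: dP => /le_lt_trans; apply; rewrite ?xy.
    rewrite tc_add_lt // => ->; exists z; rewrite tc_add_lt //.
    by rewrite xy.
  + move=> h hc; exists y; first by rewrite tc_add_gt.
    have [yx|yx] := eqVneq y (- x).
      rewrite yx tc_addN /=; move: h; rewrite yx tc_addN /= => h.
      by case: (tc_add_le hc); move: yz; rewrite -xy; lra.
    have dn : normc d = normc x by move: h; rewrite tc_add_eq // => -[].
    by move: hc; rewrite tc_add_gt ?dn ?xy // => ->.
  + exact: tc_addA_eq.
Qed.

Lemma tc_addA x y z :
  hset_add tc_add [set x] (tc_add y z) = hset_add tc_add (tc_add x y) [set z].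
Proof.
apply/seteqP; split=> c [a [b [/= h1 h2 h3]]]; subst.
  move: h2 h3; rewrite tc_addC [tc_add x b]tc_addC => h2 h3.
  have [e e1 e2] := tc_addA_sub h2 h3.
  by exists e, z; split=> //; rewrite tc_addC.
have [e e1 e2] := tc_addA_sub h1 h3.
by exists x, e.
Qed.

Lemma tc_add0 x : tc_add 0 x = [set x].
Proof.
have [->|x0] := eqVneq x 0; last first.
  by rewrite tc_add_lt // normc0 lt_neqAle eq_sym normc_eq0 x0 normc_ge0.
rewrite -{2}[0]oppr0 tc_addN normc0; apply/seteqP; split=> c /= => [h|->].
  by apply/eqP; rewrite -normc_eq0 eq_le h normc_ge0.
by rewrite normc0.
Qed.

Lemma tc_add_opp x y : tc_add x y 0 <-> y = - x.
Proof.
split=> [|->]; last by apply: tc_add_id; rewrite normc0 normc_ge0.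
have [//|yx] := eqVneq y (- x).
have [h|h|h] := ltgtP (normc x) (normc y).
- by rewrite tc_add_lt // => e; move: h; rewrite -e normc0 ltNge normc_ge0.
- by rewrite tc_add_gt // => e; move: h; rewrite -e normc0 ltNge normc_ge0.
- rewrite tc_add_eq // => -[]; rewrite normc0 => e.
  move/eqP: (e); rewrite eq_sym normc_eq0 => /eqP -> _.
  by move/eqP: h; rewrite -e eq_sym normc_eq0 => /eqP ->; rewrite oppr0.
Qed.

Lemma tc_add_rev_sub x y z : tc_add y z x -> tc_add x (- y) z.
Proof.
have [h|h|h] := ltgtP (normc y) (normc z).
- by rewrite tc_add_lt // => ->; rewrite tc_add_gt // normcNE.
- by rewrite tc_add_gt // => ->; rewrite tc_addN /= ltW.
- have [->|zy] := eqVneq z (- y).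
    rewrite tc_addN /= le_eqVlt => /orP[/eqP e|l].
      by apply: tc_addr; rewrite normcNE.
    by rewrite tc_add_lt // normcNE.
  rewrite tc_add_eq // => -[xn [s [t [s0 t0 xE]]]].
  have [te|tn] := eqVneq t 0.
    suff -> : x = y by rewrite tc_addN /= h.
    by apply: cone_id => //; exists s, t; rewrite xE te !mul0r.
  apply: tc_add_cone; rewrite ?normcNE ?xn //.
  exists t^-1, (s / t); rewrite invr_ge0 divr_ge0 //; split=> //.
  rewrite xE rmorphM fmorphV /=; field.
  by rewrite eq_complex /= negb_and tn.
Qed.

Lemma tc_add_rev x y z : tc_add y z x <-> tc_add x (- y) z.
Proof.
split; first exact: tc_add_rev_sub.
rewrite tc_addC => /tc_add_rev_sub; rewrite opprK.
by rewrite tc_addC.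
Qed.

Lemma tc_mulDr_sub a x y c : a != 0 -> tc_add x y c -> tc_add (a * x) (a * y) (a * c).
Proof.
move=> a0; have na : 0 < normc a.
  by rewrite lt_neqAle eq_sym normc_eq0 a0 normc_ge0.
have [->|yx] := eqVneq y (- x).
  by rewrite mulrN !tc_addN /= !normcM ler_pM2l.
have [h|h|h] := ltgtP (normc x) (normc y).
- by rewrite tc_add_lt // => ->; rewrite tc_add_lt // !normcM ltr_pM2l.
- by rewrite tc_add_gt // => ->; rewrite tc_add_gt // !normcM ltr_pM2l.
- rewrite tc_add_eq // => -[cn [s [t [s0 t0 cE]]]].
  apply: tc_add_cone; rewrite ?normcM ?cn ?h //.
  by exists s, t; split=> //; rewrite cE; ring.
Qed.

Lemma tc_mulDr a x y :
  [set a * c | c in tc_add x y] = tc_add (a * x) (a * y).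
Proof.
have [->|a0] := eqVneq a 0.
  rewrite !mul0r tc_add0; apply/seteqP; split=> c /=.
    by move=> [d _ <-]; rewrite mul0r.
  by move=> ->; have [d dP] := tc_add_ne x y; exists d => //; rewrite mul0r.
apply/seteqP; split=> c /=.
  by move=> [d dP <-]; apply: tc_mulDr_sub.
move=> h; exists (a^-1 * c); last by rewrite mulVKf.
by rewrite -[x](mulKf a0) -[y](mulKf a0); apply: tc_mulDr_sub; rewrite ?invr_eq0.
Qed.

Lemma tc_0neq1 : 0 <> 1 :> R[i].
Proof. by apply/eqP; rewrite eq_sym oner_neq0. Qed.

Lemma tc_mulV (x : R[i]) : x <> 0 -> exists y, x * y = 1.
Proof. by move=> /eqP x0; exists x^-1; rewrite divff. Qed.

Definition TC : hyperfield :=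
  Hyperfield tc_0neq1 (@mulrA R[i]) (@mulrC R[i]) (@mul1r R[i]) tc_mulV
    (@mul0r R[i]) tc_add_ne tc_addC tc_addA tc_add0 tc_add_opp tc_add_rev
    tc_mulDr.

End TropicalComplex.

Section Tropical.
Variable R : realType.

(* R with -oo adjoined; None stands for -oo. *)
Definition trop := option R.
Implicit Types x y z c d e : trop.

Definition tle x y : bool :=
  match x, y with
  | None, _ => true
  | Some _, None => false
  | Some a, Some b => a <= b
  end.

Definition tmax x y : trop := if tle x y then y else x.

Definition tmul x y : trop :=
  match x, y with
  | Some a, Some b => Some (a + b)
  | _, _ => None
  end.

Definition tadd x y : set trop :=
  if x == y :> option R then [set z | tle z x] else [set tmax x y].

Lemma tle_refl x : tle x x.
Proof. by case: x => //= a. Qed.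

Lemma tle_trans y x z : tle x y -> tle y z -> tle x z.
Proof. by case: x y z => [a|] [b|] [c|] //=; exact: le_trans. Qed.

Lemma tle_total x y : tle x y || tle y x.
Proof. by case: x y => [a|] [b|] //=; exact: le_total. Qed.

Lemma tle_anti x y : tle x y -> tle y x -> x = y.
Proof.
case: x y => [a|] [b|] //= ab ba; congr Some.
by apply/eqP; rewrite eq_le ab ba.
Qed.

(* The maximum of x, y, c is attained at least twice. *)
Lemma taddP x y c : tadd x y c <->
  [/\ tle x y \/ tle x c, tle y x \/ tle y c & tle c x \/ tle c y].
Proof.
rewrite /tadd /tmax; case: eqP => [->|xy] /=.
  split=> [h|[_ _ []//]]; split; by [left; exact: tle_refl|left].
have := tle_total x y; case: ifP => [l _|l /= l'].
  have nl : ~~ tle y x by apply/negP => l'; apply: xy; exact: tle_anti.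
  split=> [->|]; first by split; [left|right; exact: tle_refl|right; exact: tle_refl].
  move=> [_ [|yc]]; first by rewrite (negPf nl).
  by case=> h; [move: (tle_trans yc h); rewrite (negPf nl)|exact: tle_anti].
split=> [->|]; first by split; [right; exact: tle_refl|left|left; exact: tle_refl].
move=> -[[//|xc] _]; case=> h; first exact: tle_anti.
by move: (tle_trans xc h); rewrite l.
Qed.

Lemma taddC x y : tadd x y = tadd y x.
Proof. by apply/seteqP; split=> c /taddP[h1 h2 h3]; apply/taddP; split; tauto. Qed.

Lemma tadd_ne x y : tadd x y !=set0.
Proof. by rewrite /tadd; case: eqP => _; eexists; [exact: tle_refl|]. Qed.

Lemma tadd_max x y : tadd x y (tmax x y).
Proof. by rewrite /tadd; case: eqP => [->|//]; rewrite /tmax tle_refl /= tle_refl. Qed.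

Lemma tadd_rot x y z : tadd y z x <-> tadd x y z.
Proof. by rewrite !taddP; split=> -[h1 h2 h3]; split; tauto. Qed.

Lemma taddA_sub x y z d c :
  tadd x y d -> tadd d z c -> exists2 e, tadd y z e & tadd x e c.
Proof.
have tr := tle_trans.
move=> /taddP[h1 h2 h3] /taddP[k1 k2 k3].
have [yz|yz] := eqVneq (y : option R) z; last first.
  exists (tmax y z); first exact: tadd_max.
  have := tle_total y z; rewrite /tmax; case: ifP => [l _|l /= l'].
    have nl : ~ tle z y by move=> l'; move/eqP: yz; apply; exact: tle_anti.
    apply/taddP; split.
    - by case: h1 => [|xd]; [left; eauto|case: k1 => ?; [left|right]; eauto].
    - case: k2 => [zd|]; last by right.
      by case: h3 => h; [left; eauto|case: nl; eauto].
    - case: k3 => [cd|]; last by right.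
      by case: h3 => h; [left|right]; eauto.
  have nl : ~ tle y z by rewrite l.
  apply/taddP; split.
  - case: h1 => [|xd]; first by left.
    by case: k1 => ?; [left|right]; eauto.
  - case: h2 => [|yd]; first by left.
    by case: k1 => ?; [case: nl; eauto|right; eauto].
  - case: k3 => [cd|?]; last by right; eauto.
    by case: h3 => h; [left|right]; eauto.
have [xc|xc] := eqVneq (x : option R) c.
  exists None; rewrite ?yz ?xc; apply/taddP; split; rewrite /=; auto;
    by [left; exact: tle_refl|right; exact: tle_refl].
subst z; have := tle_total x c => /orP[l|l].
  have nl : ~ tle c x by move=> l'; move/eqP: xc; apply; exact: tle_anti.
  exists c; apply/taddP; split; try by [left; exact: tle_refl|right; exact: tle_refl|left].
  - by left; case: k3 => // ?; case: h3 => ?; [case: nl; eauto|eauto].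
have nl : ~ tle x c by move=> l'; move/eqP: xc; apply; exact: tle_anti.
exists x; apply/taddP; split; try by [left; exact: tle_refl|right; exact: tle_refl|left].
by left; case: h1 => // ?; case: k1 => ?; [eauto|case: nl; eauto].
Qed.

Lemma taddA x y z :
  hset_add tadd [set x] (tadd y z) = hset_add tadd (tadd x y) [set z].
Proof.
apply/seteqP; split=> c [a [b [/= h1 h2 h3]]]; subst.
  move: h2 h3; rewrite taddC [tadd x b]taddC => h2 h3.
  have [e e1 e2] := taddA_sub h2 h3.
  by exists e, z; split=> //; rewrite taddC.
have [e e1 e2] := taddA_sub h1 h3.
by exists x, e.
Qed.

Lemma tadd0 x : tadd None x = [set x].
Proof.
apply/seteqP; split=> c /= => [/taddP[_ h1 h2]|->].
  by case: x h1 h2 => [a|] [] // h1 [] // h2; case: c h1 h2 => // b /= h1 h2;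
    apply: tle_anti.
by apply/taddP; split; [left|right; exact: tle_refl|right; exact: tle_refl].
Qed.

Lemma tadd_opp x y : tadd x y None <-> y = x.
Proof.
split=> [/taddP[h1 h2 _]|->]; last first.
  by apply/taddP; split; left; rewrite ?tle_refl.
by case: x y h1 h2 => [a|] [b|] [] // h1 [] // h2; apply: tle_anti.
Qed.

Lemma tadd_rev x y z : tadd y z x <-> tadd x y z.
Proof. exact: tadd_rot. Qed.

Lemma tmulA x y z : tmul x (tmul y z) = tmul (tmul x y) z.
Proof. by case: x y z => [a|] [b|] [c|] //=; rewrite addrA. Qed.

Lemma tmulC x y : tmul x y = tmul y x.
Proof. by case: x y => [a|] [b|] //=; rewrite addrC. Qed.

Lemma tmul1 x : tmul (Some 0) x = x.
Proof. by case: x => //= a; rewrite add0r. Qed.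

Lemma tmulV x : x <> None -> exists y, tmul x y = Some 0.
Proof. by case: x => // a _; exists (Some (- a)); rewrite /= subrr. Qed.

Lemma tmul0 x : tmul None x = None.
Proof. by []. Qed.

Lemma t0neq1 : (None : trop) <> Some 0.
Proof. by []. Qed.

Lemma tle_mul (a : R) x y : tle (tmul (Some a) x) (tmul (Some a) y) = tle x y.
Proof. by case: x y => [b|] [c|] //=; rewrite lerD2l. Qed.

Lemma tmulDr_some (a : R) x y c :
  tadd (tmul (Some a) x) (tmul (Some a) y) (tmul (Some a) c) <-> tadd x y c.
Proof. by rewrite !taddP !tle_mul. Qed.

Lemma tmulDr a x y :
  [set tmul a c | c in tadd x y] = tadd (tmul a x) (tmul a y).
Proof.
case: a => [a|]; last first.
  rewrite tadd0; apply/seteqP; split=> c /=; first by move=> [d _ <-].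
  by move=> ->; have [d dP] := tadd_ne x y; exists d.
apply/seteqP; split=> c; first by move=> [d dP <-]; apply/tmulDr_some.
have cE : tmul (Some a) (tmul (Some (- a)) c) = c.
  by case: c => //= b; rewrite addrA subrr add0r.
by rewrite -{1}cE => /tmulDr_some h; exists (tmul (Some (- a)) c).
Qed.

Definition TT : hyperfield :=
  @Hyperfield trop tmul tadd (Some 0) None id t0neq1 tmulA tmulC tmul1 tmulV
    tmul0 tadd_ne taddC taddA tadd0 tadd_opp tadd_rev tmulDr.

End Tropical.

Section Eta.
Variable R : realType.

Definition eta_fun (z : R[i]) : trop R :=
  if z == 0 then None else Some (ln (normc z)).

Lemma eta_le (z w : R[i]) : tle (eta_fun z) (eta_fun w) = (normc z <= normc w).
Proof.
rewrite /eta_fun; case: eqP => [->|z0]; case: eqP => [->|w0];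
  rewrite ?normc0 ?normc_ge0 ?lexx //.
  by rewrite /= leNgt lt_neqAle eq_sym normc_eq0 normc_ge0 andbT; move/eqP: z0 => ->.
by rewrite /= ler_ln // posrE lt_neqAle eq_sym normc_eq0 normc_ge0 andbT; apply/eqP.
Qed.

Lemma eta_add (x y : TC R) :
  [set (eta_fun c : TT R) | c in hadd x y] `<=`
  hadd (eta_fun x : TT R) (eta_fun y : TT R).
Proof.
move=> _ [c /= h <-]; apply/taddP; rewrite !eta_le.
have [l|l|l] := ltgtP (normc x) (normc y).
- move: h; rewrite tc_add_lt // => ->; rewrite lexx (ltW l).
  by split; auto.
- move: h; rewrite tc_add_gt // => ->; rewrite lexx (ltW l).
  by split; auto.
- by split; [left|left|have := tc_add_le h; rewrite l].
Qed.

Lemma eta_mul (x y : TC R) :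
  (eta_fun (hmul x y) : TT R) = hmul (eta_fun x : TT R) (eta_fun y : TT R).
Proof.
rewrite /= /eta_fun mulf_eq0; case: eqP => [//|x0] /=; case: eqP => [//|y0] /=.
congr Some; rewrite normcM lnM // posrE lt_neqAle eq_sym normc_eq0 normc_ge0 andbT;
  exact/eqP.
Qed.

Lemma eta_zero : (eta_fun (hzero : TC R) : TT R) = hzero.
Proof. by rewrite /= /eta_fun eqxx. Qed.

Lemma eta_one : (eta_fun (hone : TC R) : TT R) = hone.
Proof. by rewrite /= /eta_fun oner_eq0 normc1 ln1. Qed.

Definition eta : hmorphism (TC R) (TT R) :=
  @HMorphism (TC R) (TT R) eta_fun eta_add eta_mul eta_zero eta_one.

End Eta.

(* Main.v *)
From HB Require Import structures.
Require Import Defs.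
From mathcomp Require Import all_boot all_order all_algebra reals.
From mathcomp Require Import boolp classical_sets sequences exp complex ring.

(** A root [b = eta a0] of the push-forward makes two of the terms
  [c_i a0^i], [c_j a0^j] have maximal modulus (or all terms vanish and [a0] is a
  root).  In that case a solution [a] of [c_i a^i = - c_j a^j] has the modulus of
  [a0], so both terms keep maximal modulus; their hypersum is the whole disc of
  that radius, which contains the opposite of any element of the hypersum of
  the remaining terms. *)

Set Implicit Arguments.
Unset Strict Implicit.
Unset Printing Implicit Defensive.
Import Order.TTheory GRing.Theory Num.Theory.
Import ComplexField.Normc.
Local Open Scope classical_set_scope.
Local Open Scope ring_scope.

Section HypersetAddition.
Variable H : hyperfield.
Implicit Types A B C : set H.

Lemma hset_addC : commutative (hset_add (@hadd H)).
Proof.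
suff sub A B : hset_add hadd A B `<=` hset_add hadd B A.
  by move=> A B; apply/seteqP; split; exact: sub.
by move=> c [a [b [Aa Bb abc]]]; exists b, a; split=> //; rewrite haddC.
Qed.

Lemma hset_add0 : left_id [set hzero] (hset_add (@hadd H)).
Proof.
move=> A; apply/seteqP; split=> c.
  by move=> [_ [b [-> Ab]]]; rewrite hadd0 => ->.
by move=> Ac; exists hzero, c; split=> //; rewrite hadd0.
Qed.

Lemma hset_addA : associative (hset_add (@hadd H)).
Proof.
move=> A B C; apply/seteqP; split=> x.
  move=> [a [d [Aa [b [c [Bb Cc bcd]]] adx]]].
  have : hset_add hadd [set a] (hadd b c) x by exists a, d.
  rewrite haddA => -[e [_ [abe -> ecx]]].
  by exists e, c; split=> //; exists a, b.
move=> [d [c [[a [b [Aa Bb abd]]] Cc dcx]]].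
have : hset_add hadd (hadd a b) [set c] x by exists d, c.
rewrite -haddA => -[_ [e [-> bce aex]]].
by exists a, e; split=> //; exists b, c.
Qed.

End HypersetAddition.

(** Makes the generic big operator lemmas, in particular extraction of chosen terms by [bigD1],
    available for finite hypersums. *)
HB.instance Definition _ (H : hyperfield) :=
  Monoid.isComLaw.Build (set H) [set hzero] (hset_add (@hadd H))
    (@hset_addA H) (@hset_addC H) (@hset_add0 H).

Lemma hset_add1 (H : hyperfield) (x y : H) :
  hset_add hadd [set x] [set y] = hadd x y.
Proof.
apply/seteqP; split=> c; first by move=> [_ [_ [-> ->]]].
by move=> xyc; exists x, y.
Qed.

Lemma hsum_nonempty (H : hyperfield) (I : finType) (P : pred I) (F : I -> H) :
  \big[hset_add hadd / [set hzero]]_(i | P i) [set F i] !=set0.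
Proof.
elim/big_ind: _ => [|A B [a Aa] [b Bb]|i _]; first by exists hzero.
- by have [c abc] := hadd_nonempty a b; exists c, a, b.
- by exists (F i).
Qed.

Lemma hsum_pair (H : hyperfield) (I : finType) (F : I -> H) (i j : I) :
  i != j ->
  \big[hset_add hadd / [set hzero]]_k [set F k] =
  hset_add hadd (hadd (F i) (F j))
    (\big[hset_add hadd / [set hzero]]_(k | (k != i) && (k != j)) [set F k]).
Proof.
move=> ij; rewrite (bigD1 i) // (bigD1 j) 1?eq_sym //= -hset_add1.
exact: hset_addA.
Qed.

Lemma hmorphism_hexp (H1 H2 : hyperfield) (f : hmorphism H1 H2) (a : H1) n :
  f (hexp a n) = hexp (f a) n.
Proof.
by elim: n => [|n IHn]; [exact: hfun_one|rewrite /hexp !iterS hfun_mul IHn].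
Qed.

Lemma heval_hpush (H1 H2 : hyperfield) (f : hmorphism H1 H2) (p : hpoly H1)
    (a : H1) :
  heval (hpush f p) (f a) = \big[hset_add hadd / [set hzero]]_(i < size p)
    [set f (hmul (nth hzero p i) (hexp a i))].
Proof.
rewrite /heval size_map; apply: eq_bigr => i _.
by rewrite hfun_mul hmorphism_hexp (nth_map hzero).
Qed.


Section Roots.
Variable R : realType.

(** Each element of a tropical hypersum of two terms lies below one of them, so a strict upper bound
    survives addition. Taking [m] real covers the empty sum, since [None] is strictly below every
    real. *)
Lemma trop_hsum_lt (I : finType) (P : pred I) (F : I -> TT R) (m : R) s :
  (forall i, P i -> ~ tle (Some m) (F i)) ->
  (\big[hset_add hadd / [set hzero]]_(i | P i) [set F i]) s ->
  ~ tle (Some m) s.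
Proof.
move=> Fm; elim/big_ind: _ s => [s -> //|A B IA IB c|i Pi s ->]; last exact: Fm.
move=> [a [b [Aa Bb /taddP[_ _ cab]]]] mc.
by case: cab => /(tle_trans mc); [exact: IA|exact: IB].
Qed.

(** If a nonzero maximal term were attained only once, the other terms would sum to values strictly
    below it, and none of these could cancel it. *)
Lemma trop_hsum_zero (I : finType) (F : I -> TT R) :
  (\big[hset_add hadd / [set hzero]]_i [set F i]) hzero ->
  (forall i, F i = hzero) \/
  exists i j, [/\ i != j, F i <> hzero, tle (F i) (F j) &
    forall k, tle (F k) (F i)].
Proof.
move=> sum0; have [[i1 Fi1]|] := pselect (exists i, F i <> hzero); last first.
  by move=> nex; left=> i; apply: contrapT => Fi; apply: nex; exists i.
right; have trans : transitive (fun x y : option R => tle y x).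
  by move=> y x z yx zy; exact: tle_trans zy yx.
(* [extremumP] yields a least element for the given relation, hence a maximum for the reversed
   order. *)
have [i _ maxi] := @extremumP (option R) I (fun x y => tle y x) i1 xpredT F
  (@tle_refl R) trans (fun x y => tle_total y x) isT.
have Fi : F i <> hzero.
  by move=> Fi; apply: Fi1; move: (maxi i1 isT); rewrite Fi; case: (F i1).
suff [j ij Fij] : exists2 j, i != j & tle (F i) (F j).
  by exists i, j; split=> // k; exact: maxi.
apply: contrapT => nex; move: sum0; rewrite (bigD1 i) //=.
(* Every element of [TT] is its own additive inverse, so [F i] itself lies in the hypersum of the
   remaining terms. *)
move=> [_ [s [-> + /tadd_opp sE]]]; subst s.
case: (F i) Fi nex => [m|//] _ nex /trop_hsum_lt; apply; last exact: tle_refl.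
by move=> j ji mj; apply: nex; exists j; rewrite 1?eq_sym.
Qed.

Lemma tc_hsum_le (I : finType) (P : pred I) (F : I -> TC R) (m : R) s :
  0 <= m -> (forall i, P i -> normc (F i) <= m) ->
  (\big[hset_add hadd / [set hzero]]_(i | P i) [set F i]) s -> normc s <= m.
Proof.
move=> m0 Fm; elim/big_ind: _ s => [s ->|A B IA IB c|i Pi s ->]; last exact: Fm.
  by rewrite normc0.
move=> [a [b [/IA am /IB bm /tc_add_le[]]]]; first by move/le_trans; apply.
by move/le_trans; apply.
Qed.

(** The opposite terms [F i] and [F j] add up to the full disc of radius [normc (F i)]. Any element
    [s] of the sum of the other terms lies in that disc, hence so does [- s]. *)
Lemma tc_hsum_zero (I : finType) (F : I -> R[i]) (i j : I) :
  i != j -> F j = - F i -> (forall k, normc (F k) <= normc (F i)) ->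
  (\big[hset_add (@hadd (TC R)) / [set hzero]]_k [set F k]) 0.
Proof.
move=> ij Fji maxi.
have [s Ss] := @hsum_nonempty (TC R) I (fun k => (k != i) && (k != j)) F.
rewrite (@hsum_pair (TC R) _ F _ _ ij); exists (- s), s; split=> //.
  rewrite Fji /= tc_addN /= normcNE.
  by apply: tc_hsum_le Ss; [exact: normc_ge0|move=> k _; exact: maxi].
by apply/tc_add_opp; rewrite opprK.
Qed.

Lemma hexp_TC (a : R[i]) n : hexp (a : TC R) n = a ^+ n.
Proof. by elim: n => // n IHn; rewrite /hexp iterS exprS -/(hexp _ n) IHn. Qed.

Lemma normcX (z : R[i]) n : normc (z ^+ n) = normc z ^+ n.
Proof.
by elim: n => [|n IHn]; rewrite ?expr0 ?normc1 // !exprS normcM IHn.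
Qed.

Lemma eta_surj (b : TT R) : exists a : TC R, eta R a = b.
Proof.
case: b => [r|]; last by exists 0; exact: eta_zero.
have e0 : normc (expR r)%:C%C = expR r by rewrite normc_real ?expR_ge0.
exists (expR r)%:C%C; rewrite /= /eta_fun e0 expRK.
by rewrite -normc_eq0 e0 gt_eqF ?expR_gt0.
Qed.

Lemma eta_normc (a a0 : R[i]) : normc a = normc a0 -> eta_fun a = eta_fun a0.
Proof. by rewrite /eta_fun -!normc_eq0 => ->. Qed.

(** It suffices to solve [a ^+ (n - m) = - c / d]; equality of the moduli at [a0] says that the
    right-hand side has modulus [normc a0 ^+ (n - m)]. *)
Lemma opposite_monomials (c d a0 : R[i]) (m n : nat) : (m < n)%N ->
  d * a0 ^+ n != 0 -> normc (c * a0 ^+ m) = normc (d * a0 ^+ n) ->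
  exists2 a, normc a = normc a0 & d * a ^+ n = - (c * a ^+ m).
Proof.
move=> mn; rewrite mulf_eq0 negb_or => /andP[d0 a0n].
have a00 : a0 != 0.
  apply: contraNneq a0n => ->.
  by rewrite expr0n gtn_eqF // (leq_ltn_trans _ mn).
have k0 : (0 < n - m)%N by rewrite subn_gt0.
rewrite -(subnK (ltnW mn)) exprD mulrA !normcM !normcX.
have am0 : normc a0 ^+ m != 0 by rewrite expf_neq0 // normc_eq0.
move/(mulIf am0) => cd.
pose a : R[i] := (n - m).-root (- c / d).
have aE : a ^+ (n - m) = - c / d by rewrite rootCK.
exists a; last by rewrite exprD aE mulrA mulrC; field.
(* Moduli are nonnegative, so they agree as soon as their powers of positive exponent [n - m] do. *)
apply/eqP; rewrite -(eqrXn2 k0) ?normc_ge0 //.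
by rewrite -!normcX aE normcM normcNE normcV cd normcX mulrC mulKf ?normc_eq0.
Qed.

End Roots.

Theorem theorem2p38 (R : realType) : RAC (eta R).
Proof.
move=> p b; have [a0 <-] := eta_surj b.
rewrite /hroots /mkset heval_hpush => /trop_hsum_zero.
pose t (a : R[i]) (i : 'I_(size p)) : R[i] := nth (hzero : TC R) p i * a ^+ i.
have tE (a : R[i]) (i : 'I_(size p)) :
    hmul (nth hzero p i) (hexp (a : TC R) i) = t a i.
  by rewrite hexp_TC.
have eta0 (z : R[i]) : eta_fun z = None -> z = 0.
  by rewrite /eta_fun; case: eqP.
case=> [all0|[i [j [ij ti0 tij maxi]]]].
  (* All terms of [p] vanish at [a0], so no change of argument is required. *)
  exists a0; split=> //; rewrite /heval big1 // => i _; congr [set _].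
  exact/eta0/all0.
rewrite !tE in ti0 tij; have {}maxi k : normc (t a0 k) <= normc (t a0 i).
  by rewrite -eta_le -!tE; exact: maxi.
have {tij} tij : normc (t a0 i) = normc (t a0 j).
  by apply/eqP; rewrite eq_le maxi andbT -eta_le.
have {ti0} ti0 : t a0 i != 0.
  by apply/eqP => ti; apply: ti0; rewrite ti; exact: eta_zero.
have [a aa0 taji] : exists2 a, normc a = normc a0 & t a j = - t a i.
  (* The larger exponent may belong to either term; the relation between opposite terms is
     symmetric. *)
  have [lt_ij|lt_ji|/val_inj eq_ij] := ltngtP i j.
  - by apply: opposite_monomials => //; rewrite -normc_eq0 -tij normc_eq0.
  - have [a aa0 e] := opposite_monomials lt_ji ti0 (esym tij).
    by exists a => //; rewrite /t e opprK.
  - by rewrite eq_ij eqxx in ij.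
(* The modulus of a term depends only on that of the argument, so maximality passes from [a0] to
   [a]. *)
have normt k : normc (t a k) = normc (t a0 k).
  by rewrite !normcM !normcX aa0.
exists a; split; first exact: eta_normc.
rewrite /heval; under eq_bigr do rewrite tE.
by apply: tc_hsum_zero ij taji _ => k; rewrite !normt.
Qed.
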